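(* Let $(R,A,\lambda)$ be the first-order data of an open processing network satisfying Assumption 1 (stated in the context), and let the matrices $H$, $B$, $M$, $\Pi$ be as defined in the context. Suppose that the $m\times b$ matrix $H$ has full row rank $m$, and let $H^+$ be a $b\times m$ right inverse of $H$, i.e. $HH^+=I$. Then the canonical basis matrix $M$ can be decomposed as $M=\Pi BH^+$, where $\Pi$ and $B$ are nonnegative matrices.
   Context: Vector inequalities are componentwise and $e\in\mathbb{R}^r$ is the vector of ones. First-order data: a real $m\times n$ matrix $R$, a nonnegative $r\times n$ matrix $A$, and a nonzero vector $\lambda\in\mathbb{R}^m_+$. Static planning problem: choose $\rho\in\mathbb{R}$, $x\in\mathbb{R}^n$ to minimize $\rho$ subject to $Rx=\lambda$, $Ax\le e\rho$, $x\ge 0$. Assumption 1: the static planning problem has a unique optimal solution $(\rho^*,x^* )$, and that solution has $\rho^*=1$ and $Ax^*=e$. Basic activities: activities (columns) are numbered so that $x^*_j>0$ for $j=1,\dots,b$ and $x_j^*=0$ for $j=b+1,\dots,n$. Partition $R=[H\;\;J]$ and $A=[B\;\;N]$, where $H$ and $B$ both have $b$ columns. Dual problem, $M$ and $\Pi$: maximize $\mu\lambda$ over the set $\mathcal{D}$ of pairs of row vectors $(\mu,\pi)\in\mathbb{R}^m\times\mathbb{R}^r$ with $\mu R\le\pi A$, $\pi e=1$, $\pi\ge0$. The distinct extreme points of $\mathcal{D}$ are $(\mu^1,\pi^1),\dots,(\mu^L,\pi^L)$. Let $d$ be the dimension of the span of those $\mu^l$ with $\mu^l\lambda=1$. Extreme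 points are numbered so that $\mu^l\lambda=1$ for $1\le l\le L^*$, $\mu^l\lambda<1$ for $L^*<l\le L$, and $\mu^1,\dots,\mu^d$ are linearly independent. The canonical basis matrix $M$ is the $d\times m$ matrix with rows $\mu^1,\dots,\mu^d$, and $\Pi$ is the $d\times r$ matrix with rows $\pi^1,\dots,\pi^d$. *)

(* Defs.v *)
From mathcomp Require Import all_boot all_order all_algebra.
From mathcomp Require Import classical_sets reals.

Set Implicit Arguments.
Unset Strict Implicit.
Unset Printing Implicit Defensive.

Import Order.TTheory GRing.Theory Num.Theory.
Local Open Scope ring_scope.
Local Open Scope classical_set_scope.

Definition mxle (F : realType) (p q : nat) (X Y : 'M[F]_(p, q)) : Prop :=
  forall i j, X i j <= Y i j.

Definition ones (F : realType) (r : nat) : 'cV[F]_r := const_mx 1.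

Definition static_feasible (F : realType) (m n r : nat) (R : 'M[F]_(m, n))
    (A : 'M[F]_(r, n)) (lambda : 'cV[F]_m) (rho : F) (x : 'cV[F]_n) : Prop :=
  [/\ R *m x = lambda, mxle (A *m x) (rho *: ones F r) & mxle 0 x].

Definition static_optimal (F : realType) (m n r : nat) (R : 'M[F]_(m, n))
    (A : 'M[F]_(r, n)) (lambda : 'cV[F]_m) (rho : F) (x : 'cV[F]_n) : Prop :=
  static_feasible R A lambda rho x /\
  forall rho' x', static_feasible R A lambda rho' x' -> rho <= rho'.

(* Heavy traffic: [(rho, x)] is the unique optimal solution of the static
   planning problem, and it uses all resources exactly to capacity. *)
Definition heavy_traffic (F : realType) (m n r : nat) (R : 'M[F]_(m, n))
    (A : 'M[F]_(r, n)) (lambda : 'cV[F]_m) (rho : F) (x : 'cV[F]_n) : Prop :=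
  [/\ static_optimal R A lambda rho x,
      forall rho' x', static_optimal R A lambda rho' x' ->
        rho' = rho /\ x' = x,
      rho = 1
    & A *m x = ones F r].

(* The columns are written [b + k] with the basic activities first, so that
   [lsubmx] and [rsubmx] give the blocks in R = [H J] and A = [B N]. *)
Definition basic_activities_first (F : realType) (b k : nat)
    (x : 'cV[F]_(b + k)) : Prop :=
  (forall j : 'I_b, 0 < x (lshift k j) 0) /\
  (forall j : 'I_k, x (rshift b j) 0 = 0).

Definition dual_feasible (F : realType) (m n r : nat) (R : 'M[F]_(m, n))
    (A : 'M[F]_(r, n)) : set ('rV[F]_m * 'rV[F]_r) :=
  [set p | [/\ mxle (p.1 *m R) (p.2 *m A), p.2 *m ones F r = 1%:M
             & mxle 0 p.2]].

Definition dual_value (F : realType) (m : nat) (lambda : 'cV[F]_m)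
    (mu : 'rV[F]_m) : F :=
  (mu *m lambda) 0 0.

Definition extreme_point (F : realType) (V : lmodType F) (D : set V) (p : V) :
    Prop :=
  D p /\
  forall (q1 q2 : V) (t : F), D q1 -> D q2 -> 0 < t -> t < 1 ->
    p = t *: q1 + (1 - t) *: q2 -> q1 = p /\ q2 = p.

(* Rows (mu^l) and (pi^l), 1 <= l <= d; indices are shifted to start at 0. *)
Definition canonical_basis_mx (F : realType) (m r d : nat)
    (E : seq ('rV[F]_m * 'rV[F]_r)) : 'M[F]_(d, m) :=
  \matrix_(l < d) (nth 0 E l).1.

Definition canonical_pi_mx (F : realType) (m r d : nat)
    (E : seq ('rV[F]_m * 'rV[F]_r)) : 'M[F]_(d, r) :=
  \matrix_(l < d) (nth 0 E l).2.

(* [E] enumerates without repetition the extreme points (mu^l, pi^l) of the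
   dual feasible set in an admissible order, with L = [size E].  The default
   value of [nth] is never reached in the canonical matrices: the span below is
   generated by at most [Lstar] vectors, hence [d <= Lstar <= size E]. *)
Record dual_numbering (F : realType) (m n r : nat) (R : 'M[F]_(m, n))
    (A : 'M[F]_(r, n)) (lambda : 'cV[F]_m) (Lstar d : nat)
    (E : seq ('rV[F]_m * 'rV[F]_r)) : Prop := DualNumbering {
  numbering_uniq : uniq E;
  numbering_extreme :
    forall p, p \in E <-> extreme_point (dual_feasible R A) p;
  numbering_Lstar : (Lstar <= size E)%N;
  numbering_optimal : forall l, (l < Lstar)%N ->
    dual_value lambda (nth 0 E l).1 = 1;
  numbering_suboptimal : forall l, (Lstar <= l)%N -> (l < size E)%N ->
    dual_value lambda (nth 0 E l).1 < 1;
  numbering_dim :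
    d = \dim <<[seq p.1 | p <- E & dual_value lambda p.1 == 1]>>%VS;
  numbering_free : row_free (canonical_basis_mx d E)
}.

(* Main.v *)
Require Import Defs.
From mathcomp Require Import all_boot all_order all_algebra.
From mathcomp Require Import classical_sets reals.

Set Implicit Arguments.
Unset Strict Implicit.
Unset Printing Implicit Defensive.

Import Order.TTheory GRing.Theory Num.Theory.
Local Open Scope ring_scope.

(** The decomposition is complementary slackness.  Each row [mu] of [M], with
    its companion [pi] in [Pi], is an optimal dual solution: [mu lambda = 1],
    the optimal value of the static planning problem.  Pairing the nonnegative
    slack [pi A - mu R] with the optimal plan [x] gives
    [pi e - mu lambda = 1 - 1 = 0], so the slack vanishes at every activity
    that [x] uses, that is, at every basic one ([complementary_slackness]).
    Restricted to the basic columns this reads [mu H = pi B], and multiplying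
    by a right inverse of [H] gives [mu = pi B H^+].

    That the first [d] extreme points are indeed dual optimal follows from
    counting: the span of dimension [d] is generated by the optimal ones, of
    which there are at most [Lstar] ([numbering_dim_le]). *)

(** A vanishing sum of nonnegative terms [(pi A - mu R)_j x_j] has only zero
    terms, and [x_j > 0] can be cancelled. *)
Lemma complementary_slackness (F : realType) (m n r : nat) (R : 'M[F]_(m, n))
    (A : 'M[F]_(r, n)) (lambda : 'cV[F]_m) (x : 'cV[F]_n)
    (p : 'rV[F]_m * 'rV[F]_r) (j : 'I_n) :
  R *m x = lambda -> A *m x = ones F r -> mxle 0 x ->
  dual_feasible R A p -> dual_value lambda p.1 = 1 -> 0 < x j 0 ->
  (p.1 *m R) 0 j = (p.2 *m A) 0 j.
Proof.
move=> Rx Ax x_ge0 [muR_le pi1 _] opt xj_gt0.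
have slack_ge0 i : true -> 0 <= (p.2 *m A - p.1 *m R) 0 i * x i 0.
  move=> _; apply: mulr_ge0; last by have := x_ge0 i 0; rewrite mxE.
  by rewrite [leRHS]mxE [X in _ + X]mxE subr_ge0.
have slack_sum0 : \sum_i (p.2 *m A - p.1 *m R) 0 i * x i 0 = 0.
  transitivity (((p.2 *m A - p.1 *m R) *m x) 0 0); first by rewrite [RHS]mxE.
  rewrite mulmxBl -!mulmxA Rx Ax pi1 [LHS]mxE [X in _ + X]mxE.
  by rewrite -/(dual_value lambda p.1) opt mxE eqxx subrr.
have /eqP := psumr_eq0P slack_ge0 slack_sum0 (erefl : true) (i := j).
rewrite mulf_eq0 (gt_eqF xj_gt0) orbF => /eqP.
by rewrite [LHS]mxE [X in _ + X]mxE => /eqP; rewrite subr_eq0 => /eqP.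
Qed.

(** Extreme points numbered from [Lstar] on are suboptimal, so at most [Lstar]
    vectors generate the span whose dimension is [d]. *)
Lemma numbering_dim_le (F : realType) (m n r : nat) (R : 'M[F]_(m, n))
    (A : 'M[F]_(r, n)) (lambda : 'cV[F]_m) (Lstar d : nat)
    (E : seq ('rV[F]_m * 'rV[F]_r)) :
  dual_numbering R A lambda Lstar d E -> (d <= Lstar)%N.
Proof.
move=> numE; rewrite (numbering_dim numE).
apply: leq_trans (dim_span _) _; rewrite size_map size_filter.
rewrite -[X in count _ X](cat_take_drop Lstar E) count_cat.
rewrite [X in (_ + X)%N](_ : _ = 0%N) ?addn0.
  by apply: leq_trans (count_size _ _) _; rewrite size_take_min geq_minl.
apply/eqP; rewrite -leqn0 leqNgt -has_count; apply/(has_nthP 0) => -[i].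
rewrite size_drop ltn_subRL nth_drop => lt_i.
by rewrite (lt_eqF (numbering_suboptimal numE (leq_addr _ _) lt_i)).
Qed.

Theorem proposition6 (F : realType) (m b k r : nat)
    (R : 'M[F]_(m, b + k)) (A : 'M[F]_(r, b + k)) (lambda : 'cV[F]_m)
    (A_ge0 : mxle 0 A) (lambda_ge0 : mxle 0 lambda) (lambda_neq0 : lambda != 0)
    (rho : F) (x : 'cV[F]_(b + k))
    (assumption1 : heavy_traffic R A lambda rho x)
    (x_basic : basic_activities_first x)
    (Lstar d : nat) (E : seq ('rV[F]_m * 'rV[F]_r))
    (E_numbering : dual_numbering R A lambda Lstar d E)
    (H_full_rank : \rank (lsubmx R) = m)
    (Hplus : 'M[F]_(b, m)) (Hplus_right_inverse : lsubmx R *m Hplus = 1%:M) :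
  let B := lsubmx A in
  let M := canonical_basis_mx d E in
  let Pi := canonical_pi_mx d E in
  [/\ M = Pi *m B *m Hplus, mxle 0 Pi & mxle 0 B].
Proof.
move=> B M Pi.
have [[[Rx _ x_ge0] _] _ _ Ax] := assumption1.
have [xB_gt0 _] := x_basic.
have le_dL := numbering_dim_le E_numbering.
have feasE (l : 'I_d) : dual_feasible R A (nth 0 E l).
  have lt_lE : (l < size E)%N.
    apply: leq_trans (ltn_ord l) _.
    exact: leq_trans le_dL (numbering_Lstar E_numbering).
  by have /(numbering_extreme E_numbering) [] := mem_nth 0 lt_lE.
split.
- suff MH : M *m lsubmx R = Pi *m B.
    by rewrite -MH -mulmxA Hplus_right_inverse mulmx1.
  apply/matrixP => l j.
  have opt := numbering_optimal E_numbering (leq_trans (ltn_ord l) le_dL).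
  have := complementary_slackness Rx Ax x_ge0 (feasE l) opt (xB_gt0 j).
  rewrite !mxE => slack; under eq_bigr do rewrite !mxE.
  by rewrite slack; apply: eq_bigr => i _; rewrite !mxE.
- by move=> l i; have [_ _ /(_ 0 i)] := feasE l; rewrite !mxE.
- by move=> i j; have := A_ge0 i (lshift k j); rewrite !mxE.
Qed.
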